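(* Let $X$ be a finite set of constant symbols and let $F$ be a ground, negation-free formula (built from atoms using only $\land$ and $\lor$) in the language of linear real arithmetic over $X$, i.e. every atom has the form $s \le t$ or $s = t$ with $s,t$ linear terms with rational coefficients in the symbols of $X$. Then $F$ is satisfiable modulo $\mathbf{LRA}$ if and only if $F$ is satisfiable modulo $\mathbf{LRR}$.
   Context: $\mathbf{LRA}$ is the theory of linear real arithmetic; $F$ is satisfiable modulo $\mathbf{LRA}$ iff some assignment of real numbers to the symbols of $X$ makes $F$ true in $\mathbb{R}$. The signature of ordered rings $\sigma_{or}$ consists of binary function symbols $+,\cdot$, constants $0,1$, equality and a binary relation $\le$; $\sigma_{or}(X)$ adds the symbols of $X$ as constants. Atoms with rational coefficients are regarded as abbreviations of $\sigma_{or}(X)$-atoms obtained by clearing denominators and moving terms (e.g. $0 \le \tfrac12 x - y$ abbreviates $(1+1)\cdot y \le x$). $\mathbf{LRR}$ (linear real rings) is the $\sigma_{or}$-theory axiomatized by: the commutative ring axioms (associativity and commutativity of $+$ and $\cdot$, $x+0=x$, $x\cdot 1 = x$, distributivity, existence of additive inverses); reflexivity, transitivity and antisymmetry of $\le$; $\forall x,y,z\,(x\le y \Rightarrow x+z \le y+z)$; $0 \le 1 \land 0 \ne 1$; for each integer $n\ge 1$, $\exists x\,(x+\dots+x = 1)$ ($n$ summands); and for each integer $n \ge 1$, $\forall x\,(0 \le x+\dots+x \Rightarrow 0 \le x)$ ($n$ summands). $F$ is satisfiable modulo $\mathbf{LRR}$ iff some $\sigma_{or}(X)$-structure that is a model of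 $\mathbf{LRR}$ satisfies $F$. *)

(* Defs.v *)
From mathcomp Require Import all_boot all_order all_algebra.
From mathcomp Require Import reals.

Set Implicit Arguments.
Unset Strict Implicit.
Unset Printing Implicit Defensive.

Import Order.TTheory GRing.Theory Num.Theory.
Local Open Scope ring_scope.

Inductive posform (A : Type) : Type :=
| PAtom of A
| PAnd of posform A & posform A
| POr of posform A & posform A.

Fixpoint pholds (A : Type) (h : A -> Prop) (F : posform A) : Prop :=
  match F with
  | PAtom a => h a
  | PAnd F1 F2 => pholds h F1 /\ pholds h F2
  | POr F1 F2 => pholds h F1 \/ pholds h F2
  end.

Fixpoint pmap_atom (A B : Type) (f : A -> B) (F : posform A) : posform B :=
  match F with
  | PAtom a => PAtom (f a)
  | PAnd F1 F2 => PAnd (pmap_atom f F1) (pmap_atom f F2)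
  | POr F1 F2 => POr (pmap_atom f F1) (pmap_atom f F2)
  end.

(* [LTerm a c] stands for the linear term  \sum_x a x * x + c. *)
Record lterm (X : finType) : Type := LTerm {
  lcoef : {ffun X -> rat};
  lconst : rat
}.

Inductive latom (X : finType) : Type :=
| LLe of lterm X & lterm X
| LEq of lterm X & lterm X.

Definition lra_formula (X : finType) : Type := posform (latom X).

Definition leval (R : realType) (X : finType) (v : X -> R) (t : lterm X) : R :=
  \sum_(x : X) ratr (lcoef t x) * v x + ratr (lconst t).

Definition latom_holds (R : realType) (X : finType) (v : X -> R)
    (a : latom X) : Prop :=
  match a with
  | LLe s t => leval v s <= leval v t
  | LEq s t => leval v s = leval v t
  end.

Definition sat_LRA (R : realType) (X : finType) (F : lra_formula X) : Prop :=
  exists v : X -> R, pholds (latom_holds v) F.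

Inductive or_term (X : Type) : Type :=
| TSym of X
| TZero
| TOne
| TAdd of or_term X & or_term X
| TMul of or_term X & or_term X.

Arguments TZero {X}.
Arguments TOne {X}.

Inductive or_atom (X : Type) : Type :=
| ALe of or_term X & or_term X
| AEq of or_term X & or_term X.

Record or_structure : Type := OrStructure {
  or_carrier :> Type;
  or_zero : or_carrier;
  or_one : or_carrier;
  or_add : or_carrier -> or_carrier -> or_carrier;
  or_mul : or_carrier -> or_carrier -> or_carrier;
  or_le : or_carrier -> or_carrier -> Prop
}.

Fixpoint or_eval (X : Type) (M : or_structure) (I : X -> M)
    (t : or_term X) : M :=
  match t with
  | TSym x => I x
  | TZero => or_zero M
  | TOne => or_one M
  | TAdd s t => or_add (or_eval I s) (or_eval I t)
  | TMul s t => or_mul (or_eval I s) (or_eval I t)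
  end.

Definition or_atom_holds (X : Type) (M : or_structure) (I : X -> M)
    (a : or_atom X) : Prop :=
  match a with
  | ALe s t => or_le (or_eval I s) (or_eval I t)
  | AEq s t => or_eval I s = or_eval I t
  end.

(* x + ... + x with n summands, for 0 < n *)
Definition or_nsum (M : or_structure) (n : nat) (x : M) : M :=
  iterop n (@or_add M) x (or_zero M).

Record LRR_model (M : or_structure) : Prop := LRRModel {
  LRR_addA : forall x y z : M,
    or_add x (or_add y z) = or_add (or_add x y) z;
  LRR_addC : forall x y : M, or_add x y = or_add y x;
  LRR_mulA : forall x y z : M,
    or_mul x (or_mul y z) = or_mul (or_mul x y) z;
  LRR_mulC : forall x y : M, or_mul x y = or_mul y x;
  LRR_add0 : forall x : M, or_add x (or_zero M) = x;
  LRR_mul1 : forall x : M, or_mul x (or_one M) = x;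
  LRR_mulD : forall x y z : M,
    or_mul x (or_add y z) = or_add (or_mul x y) (or_mul x z);
  LRR_opp : forall x : M, exists y : M, or_add x y = or_zero M;
  LRR_le_refl : forall x : M, or_le x x;
  LRR_le_trans : forall x y z : M, or_le x y -> or_le y z -> or_le x z;
  LRR_le_anti : forall x y : M, or_le x y -> or_le y x -> x = y;
  LRR_leD : forall x y z : M, or_le x y -> or_le (or_add x z) (or_add y z);
  LRR_01 : or_le (or_zero M) (or_one M) /\ or_zero M <> or_one M;
  LRR_div : forall n : nat, (0 < n)%N ->
    exists x : M, or_nsum n x = or_one M;
  LRR_perf : forall n : nat, (0 < n)%N ->
    forall x : M, or_le (or_zero M) (or_nsum n x) -> or_le (or_zero M) x
}.

(* The numeral 1 + ... + 1, and 0 for n = 0. *)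
Definition or_numeral (X : Type) (n : nat) : or_term X :=
  iterop n (@TAdd X) TOne TZero.

(* \sum_x a x * x + c with natural-number coefficients; null monomials are
   omitted. *)
Definition nat_lterm (X : finType) (a : X -> nat) (c : nat) : or_term X :=
  TAdd (\big[@TAdd X/TZero]_(x : X | (0 < a x)%N)
          TMul (or_numeral X (a x)) (TSym x))
       (or_numeral X c).

Definition int_pos (z : int) : nat := if z is Posz n then n else 0%N.
Definition int_neg (z : int) : nat := int_pos (- z).

(* The pair (l, r) of terms such that s <= t (resp. s = t) abbreviates l <= r
   (resp. l = r): with D the least common denominator of the coefficients of
   t - s, the term D (t - s) has integer coefficients; its negative monomials
   are moved to the left-hand side, and the positive ones stay on the right. *)
Definition clear_sides (X : finType) (s t : lterm X) :
    or_term X * or_term X :=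
  let d x := lcoef t x - lcoef s x in
  let d0 := lconst t - lconst s in
  let D := lcmn (\big[lcmn/1%N]_(x : X) `|denq (d x)|%N) `|denq d0|%N in
  let z x := numq (D%:R * d x) in
  let z0 := numq (D%:R * d0) in
  (nat_lterm (fun x => int_neg (z x)) (int_neg z0),
   nat_lterm (fun x => int_pos (z x)) (int_pos z0)).

Definition abbrev (X : finType) (a : latom X) : or_atom X :=
  match a with
  | LLe s t => let lr := clear_sides s t in ALe lr.1 lr.2
  | LEq s t => let lr := clear_sides s t in AEq lr.1 lr.2
  end.

Definition sat_LRR (X : Type) (F : posform (or_atom X)) : Prop :=
  exists (M : or_structure) (I : X -> M),
    LRR_model M /\ pholds (or_atom_holds I) F.

(* Main.v *)
Require Import Defs.
From HB Require Import structures.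
From mathcomp Require Import all_boot all_order all_algebra.
From mathcomp Require Import boolp reals.
From mathcomp Require Import lra.

(** An atom over [X] amounts to one or two inequalities [0 <= f] for an affine
form [f] with integer coefficients.  Over [R] the two readings agree up to a
positive factor, and [R] itself is a model of LRR.  Conversely, let a model [M]
with valuation [I] satisfy [F], and keep the finitely many forms coming from the
atoms that are true in [M].  The forms [f] with [0 <= f I] in [M] are closed
under combinations with natural coefficients, and a constant one among them is
nonnegative because [0 <= 1] and [0 <> 1].  Hence Fourier-Motzkin elimination,
which only takes such combinations, ends in true inequalities between constants
and back-substitution yields a real solution. *)

Set Implicit Arguments.
Unset Strict Implicit.
Unset Printing Implicit Defensive.

Import Order.TTheory GRing.Theory Num.Theory.
Local Open Scope ring_scope.

(** * Integer affine forms *)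

(* The coefficient at [None] is the constant term. *)
Notation aform X := {ffun option X -> int}.

Definition aeval (A : pzRingType) (X : finType) (v : X -> A) (f : aform X) : A :=
  \sum_(x : X) v x *~ f (Some x) + (f None)%:~R.

Lemma aevalD (A : pzRingType) (X : finType) (v : X -> A) (f g : aform X) :
  aeval v (f + g) = aeval v f + aeval v g.
Proof.
rewrite /aeval ffunE mulrzDr addrACA -big_split; congr (_ + _).
by apply: eq_bigr => x _; rewrite ffunE mulrzDr.
Qed.

Lemma aevalN (A : pzRingType) (X : finType) (v : X -> A) (f : aform X) :
  aeval v (- f) = - aeval v f.
Proof.
rewrite /aeval ffunE mulrNz opprD -sumrN; congr (_ + _).
by apply: eq_bigr => x _; rewrite ffunE mulrNz.
Qed.

Lemma aevalMn (A : pzRingType) (X : finType) (v : X -> A) (f : aform X) n :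
  aeval v (f *+ n) = aeval v f *+ n.
Proof.
elim: n => [|n IHn]; last by rewrite !mulrS aevalD IHn.
rewrite !mulr0n /aeval ffunE addr0 big1 // => x _.
by rewrite ffunE.
Qed.

Lemma aeval_const (A : pzRingType) (X : finType) (v : X -> A) (f : aform X) :
  (forall x, f (Some x) = 0) -> aeval v f = (f None)%:~R.
Proof. by move=> f0; rewrite /aeval big1 ?add0r // => x _; rewrite f0. Qed.

Lemma aeval_update (A : pzRingType) (X : finType) (v : X -> A) (x : X) (u : A)
    (f : aform X) :
  aeval (fun y => if y == x then v y + u else v y) f =
  aeval v f + u *~ f (Some x).
Proof.
rewrite /aeval (bigD1 x) //= eqxx [in RHS](bigD1 x) //= mulrzDl.
rewrite (eq_bigr (fun y => v y *~ f (Some y))) => [|y /negPf -> //].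
by rewrite -!addrA; congr (_ + _); rewrite addrC !addrA.
Qed.

(** * Fourier-Motzkin elimination *)

(** This supplies the value of the variable being eliminated: any point between the largest lower
    bound and the smallest upper bound, either of which may be absent. *)
Lemma seq_separation (K : realDomainType) (lo hi : seq K) :
  {in lo & hi, forall a b, a <= b} ->
  exists u, {in lo, forall a, a <= u} /\ {in hi, forall b, u <= b}.
Proof.
elim: lo => [_|a lo IHlo le_lohi].
  elim: hi => [|b hi [u [_ le_u]]]; first by exists 0.
  exists (Num.min u b); split=> // c; rewrite inE ge_min => /predU1P[->|/le_u ->//].
  by rewrite lexx orbT.
have [|u [le_lo le_hi]] := IHlo.
  by move=> c b c_lo; apply: le_lohi; rewrite inE c_lo orbT.
exists (Num.max u a); split=> [c|b b_hi].
  rewrite inE le_max => /predU1P[->|/le_lo ->//].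
  by rewrite lexx orbT.
by rewrite ge_max le_hi //= le_lohi ?inE ?eqxx.
Qed.

(** [P] will be nonnegativity in a given model of LRR. Only natural multiples are taken on that
    side; division happens in [K] alone. *)
Lemma fourier_motzkin (K : realFieldType) (X : finType) (P : aform X -> Prop) :
  (forall f g m n, P f -> P g -> P (f *+ m + g *+ n)) ->
  (forall f, P f -> (forall x, f (Some x) = 0) -> 0 <= f None) ->
  forall l : seq (aform X), {in l, forall f, P f} ->
  exists v : X -> K, {in l, forall f, 0 <= aeval v f}.
Proof.
move=> Pcomb Pconst l Pl.
(* Induction on the list of variables still allowed to occur; variables already eliminated have
   coefficient zero in every form of [l]. *)
have: {in l, forall (f : aform X) x, x \notin enum X -> f (Some x) = 0}.
  by move=> f _ x; rewrite mem_enum.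
elim: (enum X) l Pl => [|x s IHs] l Pl l0.
  exists (fun=> 0) => f fl; have f0 y : f (Some y) = 0 by rewrite (l0 f).
  by rewrite aeval_const // ler0z Pconst //; apply: Pl.
pose pos := [seq f : aform X <- l | 0 < f (Some x)].
pose neg := [seq f : aform X <- l | f (Some x) < 0].
(* Each multiplier is the absolute value of the other form's coefficient at [x]; for opposite signs
   the two contributions at [x] cancel. *)
pose comb (f g : aform X) := f *+ `|g (Some x)|%N + g *+ `|f (Some x)|%N.
have [||v v_ge0] := IHs ([seq f : aform X <- l | f (Some x) == 0] ++
                         [seq comb f g | f <- pos, g <- neg]).
- move=> f; rewrite mem_cat mem_filter => /orP[/andP[_ /Pl //]|].
  case/allpairsP=> -[g h] [/=]; rewrite !mem_filter => /andP[_ /Pl Pg].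
  by move=> /andP[_ /Pl Ph] ->; apply: Pcomb.
- move=> f; rewrite mem_cat mem_filter => /orP[/andP[/eqP fx0 fl] y ys|].
    have [-> //|yx] := eqVneq y x.
    by apply: l0 => //; rewrite inE negb_or yx.
  case/allpairsP=> -[g h] [/=]; rewrite !mem_filter => /andP[gx gl].
  move=> /andP[hx hl] -> y ys; rewrite !ffunE !ffunMnE.
  have [->|yx] := eqVneq y x; last first.
    have yxs : y \notin x :: s by rewrite inE negb_or yx.
    by rewrite !(l0 _ _ _ yxs) // !mul0rn addr0.
  rewrite -[_ *+ `|h _|]mulr_natr -[_ *+ `|g _|]mulr_natr !natz !abszE.
  by rewrite (gtr0_norm gx) (ltr0_norm hx) mulrN mulrC addNr.
(* Here [u] is an increment to [v x]. By [aeval_update], [f] becomes [aeval v f + u * f_x], so a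
   positive [f_x] bounds [u] from below and a negative one from above. *)
have [|u [u_lo u_hi]] := @seq_separation K
  [seq - aeval v f / (f (Some x))%:~R | f : aform X <- pos]
  [seq - aeval v f / (f (Some x))%:~R | f : aform X <- neg].
  move=> _ _ /mapP[f f_pos ->] /mapP[g g_neg ->].
  have : 0 <= aeval v (comb f g).
    by apply: v_ge0; rewrite mem_cat; apply/orP; right; apply: allpairs_f.
  move: f_pos g_neg; rewrite !mem_filter => /andP[fx _] /andP[gx _].
  rewrite aevalD !aevalMn -[_ *+ `|g _|]mulr_natr -[_ *+ `|f _|]mulr_natr.
  rewrite !pmulrn !abszE (gtr0_norm fx) (ltr0_norm gx) mulrNz.
  move: fx gx; rewrite -(ltr0z K) -(ltrz0 K).
  move: (_%:~R) (_%:~R) => a b a_gt0 b_lt0 comb_ge0.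
  rewrite ler_pdivrMr // mulrAC ler_ndivlMr //; lra.
exists (fun y => if y == x then v y + u else v y) => f fl.
rewrite aeval_update -mulrzr.
have [fx|fx|fx0] := ltgtP (f (Some x)) 0; last first.
- rewrite fx0 mulr0 addr0; apply: v_ge0.
  by rewrite mem_cat mem_filter fx0 eqxx fl.
- suff: - aeval v f / (f (Some x))%:~R <= u.
    by rewrite ler_pdivrMr ?ltr0z // -subr_ge0 opprK addrC.
  by apply/u_lo/map_f; rewrite mem_filter fx.
suff: u <= - aeval v f / (f (Some x))%:~R.
  by rewrite ler_ndivlMr ?ltrz0 // -subr_ge0 opprK addrC.
by apply/u_hi/map_f; rewrite mem_filter fx.
Qed.

(** * Ordered rings as structures *)

Definition ring_structure (A : pzRingType) (le : A -> A -> Prop) : or_structure :=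
  @OrStructure A 0 1 +%R *%R le.

(** Choice turns the existence of additive inverses into an opposite function, and classical
    equality and choice on the carrier supply the rest of the ring structure. The operations of [M]
    are kept, hence an equality of structures. *)
Lemma LRR_model_ring (M : or_structure) : LRR_model M ->
  exists (A : comPzRingType) (le : A -> A -> Prop), M = ring_structure le.
Proof.
case: M => T zero one add mul le [] /= addA addC mulA mulC add0 mul1 mulD opp.
do 7 move=> _; have [neg negP] := choice opp.
have negK : left_inverse zero neg add by move=> x; rewrite addC negP.
have add0l : left_id zero add by move=> x; rewrite addC add0.
have mul1l : left_id one mul by move=> x; rewrite mulC mul1.
have mulDl : left_distributive mul add.
  by move=> x y z; rewrite mulC mulD !(mulC z).
pose C := HB.pack_for choiceType T (gen_eqMixin T) (gen_choiceMixin T).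
pose Z := HB.pack_for zmodType C
  (GRing.isZmodule.Build C addA addC add0l negK).
pose A := HB.pack_for comPzRingType Z
  (GRing.Zmodule_isComPzRing.Build Z mulA mulC mul1l mulDl).
by exists A, le.
Qed.

Lemma or_eval_numeral (A : pzRingType) (le : A -> A -> Prop) (X : Type)
    (I : X -> ring_structure le) n :
  or_eval I (or_numeral X n) = n%:R.
Proof.
case: n => // n; rewrite /or_numeral.
by elim: n => // n IHn; rewrite [iterop _ _ _ _]/= /= IHn -mulrS.
Qed.

Lemma or_eval_nat_lterm (A : pzRingType) (le : A -> A -> Prop) (X : finType)
    (I : X -> ring_structure le) (a : X -> nat) c :
  or_eval I (nat_lterm a c) = \sum_(x : X) (I x : A) *+ a x + c%:R :> A.
Proof.
rewrite /nat_lterm /= or_eval_numeral; congr (_ + _).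
(* The monomials omitted by [nat_lterm] have coefficient zero and add nothing to the full sum. *)
rewrite [RHS](bigID (fun x => 0 < a x)%N) /= [X in _ + X]big1 ?addr0; last first.
  by move=> x; rewrite lt0n negbK => /eqP->.
rewrite (big_morph (fun t => or_eval I t : A) (id1 := 0) (op1 := +%R)) //.
by apply: eq_bigr => x _; rewrite /= or_eval_numeral mulr_natl.
Qed.

(** * Clearing denominators *)

Definition clear_den (X : finType) (s t : lterm X) : nat :=
  lcmn (\big[lcmn/1%N]_(x : X) `|denq (lcoef t x - lcoef s x)|%N)
       `|denq (lconst t - lconst s)|%N.

(** The right side minus the left side of [clear_sides s t], before the coefficients are split by
    sign. *)
Definition clear_form (X : finType) (s t : lterm X) : aform X :=
  [ffun o => numq ((clear_den s t)%:R *
     (if o is Some x then lcoef t x - lcoef s x else lconst t - lconst s))].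

Lemma clear_den_gt0 (X : finType) (s t : lterm X) : (0 < clear_den s t)%N.
Proof.
rewrite lcmn_gt0 absz_gt0 denq_eq0 andbT.
by elim/big_ind: _ => // [m n|x _]; rewrite ?lcmn_gt0 ?absz_gt0 ?denq_eq0 // => -> ->.
Qed.

Lemma int_posB_neg (z : int) : (int_pos z)%:Z - (int_neg z)%:Z = z.
Proof. by case: z => [[|n]|n] //=; rewrite ?subr0 // sub0r. Qed.

Lemma aeval_clear_form (A : pzRingType) (le : A -> A -> Prop) (X : finType)
    (I : X -> ring_structure le) (s t : lterm X) :
  aeval (I : X -> A) (clear_form s t) =
  (or_eval I (clear_sides s t).2 : A) - or_eval I (clear_sides s t).1.
Proof.
rewrite !or_eval_nat_lterm opprD addrACA -sumrB /aeval.
congr (_ + _); last first.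
  by rewrite ffunE -{1}[numq _]int_posB_neg mulrzBr.
by apply: eq_bigr => x _; rewrite ffunE -{1}[numq _]int_posB_neg mulrzBr.
Qed.

(** Taking [numq] is harmless on integers, and clearing the denominator makes the product one. *)
Lemma numq_denM (d : nat) (q : rat) : (`|denq q| %| d)%N ->
  (numq (d%:R * q))%:~R = d%:R * q :> rat.
Proof.
case/dvdnP=> k ->; apply: numqK.
have -> : (k * `|denq q|)%:R * q = (k%:Z * numq q)%:~R.
  rewrite natrM -mulrA intrM pmulrn; congr (_ * _).
  by rewrite pmulrn abszE gtr0_norm ?denq_gt0 // mulrC numqE.
exact: intr_int.
Qed.

Lemma aeval_clear_formR (R : realType) (X : finType) (v : X -> R)
    (s t : lterm X) :
  aeval v (clear_form s t) = (clear_den s t)%:R * (leval v t - leval v s).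
Proof.
have cf o : (clear_form s t o)%:~R = ratr ((clear_den s t)%:R *
     (if o is Some x then lcoef t x - lcoef s x else lconst t - lconst s)) :> R.
  rewrite ffunE -ratr_int numq_denM //.
  case: o => [x|]; last exact: dvdn_lcmr.
  by apply: dvdn_trans (dvdn_lcml _ _); apply: (biglcmn_sup x).
rewrite /leval opprD addrACA -sumrB mulrDr mulr_sumr /aeval cf.
rewrite rmorphM rmorphB /= ratr_nat; congr (_ + _).
apply: eq_bigr => x _.
by rewrite -mulrzr cf rmorphM rmorphB /= ratr_nat mulrC -mulrBl mulrA.
Qed.

(** * Atoms as inequalities *)

Definition atom_forms (X : finType) (a : latom X) : seq (aform X) :=
  match a with
  | LLe s t => [:: clear_form s t]
  | LEq s t => [:: clear_form s t; - clear_form s t]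
  end.

Lemma forall_atom_forms (X : finType) (Q : aform X -> Prop) (a : latom X) :
  {in atom_forms a, forall f, Q f} <->
  match a with
  | LLe s t => Q (clear_form s t)
  | LEq s t => Q (clear_form s t) /\ Q (- clear_form s t)
  end.
Proof.
case: a => s t /=; split=> [Qa|].
- by apply: Qa; rewrite inE.
- by move=> Qf f; rewrite inE => /eqP->.
- by split; apply: Qa; rewrite !inE eqxx ?orbT.
- by case=> Qf QNf f; rewrite !inE => /orP[]/eqP->.
Qed.

(** Translation invariance of the order moves both sides to one; reflexivity and antisymmetry turn
    an equality into two inequalities. *)
Lemma or_atom_holds_forms (A : pzRingType) (le : A -> A -> Prop) (X : finType)
    (I : X -> ring_structure le) (a : latom X) :
  LRR_model (ring_structure le) ->
  or_atom_holds I (abbrev a) <->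
  {in atom_forms a, forall f, le 0 (aeval (I : X -> A) f)}.
Proof.
case=> _ _ _ _ _ _ _ _ le_refl _ le_anti leD _ _ _; rewrite forall_atom_forms.
have le_sub (x y : A) : le x y <-> le 0 (y - x).
  split=> [/(leD _ _ (- x))|/(leD _ _ x)]; rewrite /= ?subrr //.
  by rewrite add0r subrK.
case: a => s t; rewrite ?aevalN aeval_clear_form /or_atom_holds /abbrev.
  exact: le_sub.
rewrite opprB -!le_sub; split=> [->|[]]; first by split; apply: le_refl.
exact: le_anti.
Qed.

Lemma latom_holds_forms (R : realType) (X : finType) (v : X -> R) (a : latom X) :
  latom_holds v a <-> {in atom_forms a, forall f, 0 <= aeval v f}.
Proof.
rewrite forall_atom_forms; case: a => s t /=; rewrite ?aevalN aeval_clear_formR.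
  by rewrite pmulr_rge0 ?ltr0n ?clear_den_gt0 // subr_ge0.
rewrite -mulrN !pmulr_rge0 ?ltr0n ?clear_den_gt0 // opprB !subr_ge0.
by split=> [->//|[? ?]]; apply/eqP; rewrite eq_le; apply/andP.
Qed.

(** * Positive formulas *)

Lemma pholds_pmap_atom (A B : Type) (f : A -> B) (h : B -> Prop) F :
  pholds h (pmap_atom f F) <-> pholds (fun a => h (f a)) F.
Proof. by elim: F => //= F1 IH1 F2 IH2; rewrite IH1 IH2. Qed.

Lemma eq_pholds (A : Type) (h k : A -> Prop) F :
  (forall a, h a <-> k a) -> pholds h F <-> pholds k F.
Proof. by move=> hk; elim: F => //= F1 IH1 F2 IH2; rewrite IH1 IH2. Qed.

(** Without negation, truth is monotone in the atoms: collect the forms of both conjuncts and of one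
    true disjunct. Any [Q'] true on this list makes the formula true. *)
Lemma pholds_witness (A : Type) (T : eqType) (s : A -> seq T) (Q : T -> Prop) F :
  pholds (fun a => {in s a, forall f, Q f}) F ->
  exists l : seq T, {in l, forall f, Q f} /\
    forall Q' : T -> Prop, {in l, forall f, Q' f} ->
      pholds (fun a => {in s a, forall f, Q' f}) F.
Proof.
elim: F => [a Qa|F1 IH1 F2 IH2 [/IH1[l1 [Ql1 Hl1]] /IH2[l2 [Ql2 Hl2]]]|F1 IH1 F2 IH2].
- by exists (s a).
- exists (l1 ++ l2); split=> [f|Q' Ql].
    by rewrite mem_cat => /orP[/Ql1|/Ql2].
  by split; [apply: Hl1|apply: Hl2] => f fl; apply: Ql; rewrite mem_cat fl ?orbT.
- move=> [/IH1[l [Ql Hl]]|/IH2[l [Ql Hl]]]; exists l; split=> // Q' /Hl.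
    by left.
  by right.
Qed.

(** * Models of LRR *)

Lemma LRR_model_real (R : realType) :
  LRR_model (ring_structure (fun x y : R => x <= y)).
Proof.
have nsumE n x : or_nsum n x = x *+ n :> ring_structure (fun x y : R => x <= y).
  by case: n.
split=> /=.
- exact: addrA.
- exact: addrC.
- exact: mulrA.
- exact: mulrC.
- exact: addr0.
- exact: mulr1.
- exact: mulrDr.
- by move=> x; exists (- x); rewrite subrr.
- exact: lexx.
- by move=> x y z; apply: le_trans.
- by move=> x y xy yx; apply/eqP; rewrite eq_le xy.
- by move=> x y z; rewrite lerD2r.
- by split; [apply: ler01 | apply/eqP; rewrite eq_sym oner_eq0].
- move=> n n_gt0; exists (n%:R^-1); rewrite nsumE -[_ *+ n]mulr_natr mulVf //.
  by rewrite pnatr_eq0 -lt0n.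
- by move=> n n_gt0 x; rewrite nsumE pmulrn_lge0.
Qed.

Section RingModel.
Variables (A : pzRingType) (le : A -> A -> Prop).
Hypothesis modelA : LRR_model (ring_structure le).

Let leD2r : forall x y z, le x y -> le (x + z) (y + z) := LRR_leD modelA.
Let leT : forall x y z, le x y -> le y z -> le x z := LRR_le_trans modelA.

Lemma model_le0D (x y : A) : le 0 x -> le 0 y -> le 0 (x + y).
Proof. by move=> x0 /(leD2r x); rewrite add0r addrC; apply: leT. Qed.

Lemma model_le0Mn (x : A) n : le 0 x -> le 0 (x *+ n).
Proof.
move=> x0; elim: n => [|n IHn]; last by rewrite mulrS; apply: model_le0D.
exact: (LRR_le_refl modelA).
Qed.

(** If [-(n+1)] were nonnegative, adding [n] would give [0 <= n <= -1], so [1 <= 0] and antisymmetry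
    would force [0 = 1]. *)
Lemma model_le0_intr (z : int) : le 0 z%:~R -> 0 <= z.
Proof.
case: z => // n; rewrite NegzE mulrNz => /(leD2r n%:R).
have [le01 neq01] := LRR_01 modelA.
rewrite add0r -pmulrn -natr1 opprD addrC addrA subrr add0r => le_nN1.
have := leT (model_le0Mn n le01) le_nN1 => /(leD2r 1).
by rewrite add0r addNr => le10; case: neq01; apply: (LRR_le_anti modelA).
Qed.

End RingModel.

Theorem theorem3p1 (R : realType) (X : finType) (F : lra_formula X) :
  sat_LRA R F <-> sat_LRR (pmap_atom (@abbrev X) F).
Proof.
split=> [[v vF]|[M [I [modelM]]]].
  exists (ring_structure (fun x y : R => x <= y)), v.
  split; first exact: LRR_model_real.
  apply/pholds_pmap_atom; move: vF; apply: (eq_pholds _ _).1 => a.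
  by rewrite latom_holds_forms (or_atom_holds_forms _ _ (LRR_model_real R)).
have [A [le MA]] := LRR_model_ring modelM; subst M.
move/pholds_pmap_atom.
move/(eq_pholds _ (fun a => or_atom_holds_forms I a modelM)).1.
move/pholds_witness => [l [l_ge0 lF]].
(* The predicate [P], inferred from [l_ge0], is nonnegativity of the form at [I] in the model. *)
have [||v v_ge0] := @fourier_motzkin R X _ _ _ l l_ge0.
- move=> f g m n f_ge0 g_ge0; rewrite aevalD !aevalMn.
  by apply: (model_le0D modelM); apply: (model_le0Mn modelM).
- by move=> f + f0; rewrite aeval_const //; apply: model_le0_intr.
exists v; apply: (eq_pholds _ (latom_holds_forms v)).2.
exact: lF.
Qed.
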